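(* Assume that the events $E_1,E_2,E_3,H_1,H_2,H_3$ are logically independent, with $H_1\neq\emptyset$, $H_2\neq\emptyset$, $H_3\neq\emptyset$. Then the set $\Pi$ of all coherent assessments $\mathcal{M}=(x_1,x_2,x_3,x_{12},x_{13},x_{23},x_{123})$ on $$\mathcal{F}=\{E_1|H_1,\,E_2|H_2,\,E_3|H_3,\,(E_1|H_1)\wedge(E_2|H_2),\,(E_1|H_1)\wedge(E_3|H_3),\,(E_2|H_2)\wedge(E_3|H_3),\,(E_1|H_1)\wedge(E_2|H_2)\wedge(E_3|H_3)\}$$ is the set of points $(x_1,x_2,x_3,x_{12},x_{13},x_{23},x_{123})$ which satisfy the following conditions: $$\left\{\begin{array}{l} (x_1,x_2,x_3)\in[0,1]^3,\\ \max\{x_1+x_2-1,\,x_{13}+x_{23}-x_3,\,0\}\leq x_{12}\leq\min\{x_1,x_2\},\\ \max\{x_1+x_3-1,\,x_{12}+x_{23}-x_2,\,0\}\leq x_{13}\leq\min\{x_1,x_3\},\\ \max\{x_2+x_3-1,\,x_{12}+x_{13}-x_1,\,0\}\leq x_{23}\leq\min\{x_2,x_3\},\\ 1-x_1-x_2-x_3+x_{12}+x_{13}+x_{23}\geq 0,\\ x_{123}\geq\max\{0,\,x_{12}+x_{13}-x_1,\,x_{12}+x_{23}-x_2,\,x_{13}+x_{23}-x_3\},\\ x_{123}\leq\min\{x_{12},\,x_{13},\,x_{23},\,1-x_1-x_2-x_3+x_{12}+x_{13}+x_{23}\}. \end{array}\right.$$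
   Context: Events are two-valued propositions (identified with subsets of the sure event $\Omega$, and with their indicators); $\overline{A}$ is negation, $AB$ is conjunction. Events $A_1,\ldots,A_r$ are logically independent if all $2^r$ conjunctions $\bigwedge_i A_i^{*}$, with $A_i^*\in\{A_i,\overline{A}_i\}$, are possible (nonempty). For events $E,H$ with $H\neq\emptyset$, the conditional event $E|H$ is true if $EH$ is true, false if $\overline{E}H$ is true, void if $\overline{H}$ is true. A conditional random quantity $X|H$ ($X$ with finitely many values) with assessed prevision $\mu=\mathbb{P}(X|H)$ is identified with the random quantity $XH+\mu\overline{H}$; in particular $E|H=EH+x\overline{H}$ with $x=P(E|H)$. Coherence: an assessment of previsions $\mu_j=\mathbb{P}(X_j|K_j)$ on a family of conditional random quantities is coherent if, for every finite subfamily $\{X_1|K_1,\ldots,X_r|K_r\}$ and all real $s_1,\ldots,s_r$, the gain $G=\sum_j s_jK_j(X_j-\mu_j)$ restricted to $K_1\vee\cdots\vee K_r$ satisfies $\min G\leq 0\leq\max G$. Conjunctions. $x_i=P(E_i|H_i)$, $x_{ij}=x_{ji}=\mathbb{P}[(E_i|H_i)\wedge(E_j|H_j)]$, $x_{123}=\mathbb{P}[(E_1|H_1)\wedge(E_2|H_2)\wedge(E_3|H_3)]$; write $x_S$ for the number indexed by nonempty $S\subseteq\{1,2,3\}$. The conjunction $\bigwedge_{i\in S}(E_i|H_i)$ is the random quantity, conditional on $\bigvee_{i\in S}H_i$, with value $1$ if all $E_i|H_i$, $i\in S$, are true; $0$ if at least one is false; $x_V$ if none is false and the set $V\subseteq S$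 of indices of void ones is nonempty (so its value is its prevision $x_S$ when all $H_i$, $i\in S$, are false). *)

(* Defs.v *)
From HB Require Import structures.
From mathcomp Require Import all_boot all_order all_algebra.
From mathcomp Require Import all_classical reals numfun.

Set Implicit Arguments.
Unset Strict Implicit.
Unset Printing Implicit Defensive.

Import Order.TTheory GRing.Theory Num.Theory.

Local Open Scope classical_set_scope.
Local Open Scope ring_scope.

(* The sure event is a type [Omega]; events are sets [A : set Omega], identified
   with their indicators [\1_A]. *)

Definition logically_independent (Omega I : Type) (A : I -> set Omega) : Prop :=
  forall b : I -> bool,
    \bigcap_i (if b i then A i else ~` A i) !=set0.

(* The pair [CondRQ X K] stands for X|K.  The values of X outside of K are
   immaterial, since the gain multiplies X - mu by the indicator of K: replacing
   X by X K + mu (1 - K) gives the same gain. *)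
Record cond_rq (Omega : Type) (R : realType) := CondRQ {
  rq_val : {fimfun Omega >-> R};
  rq_cond : set Omega
}.

Definition gain (Omega : Type) (R : realType) (r : nat)
    (X : 'I_r -> cond_rq Omega R) (mu s : 'I_r -> R) (w : Omega) : R :=
  \sum_(j < r) s j * \1_(rq_cond (X j)) w * (rq_val (X j) w - mu j).

Definition is_min (R : realType) (A : set R) (m : R) : Prop :=
  A m /\ lbound A m.

Definition is_max (R : realType) (A : set R) (m : R) : Prop :=
  A m /\ ubound A m.

(* Finite subfamilies are nonempty: the empty one would have conditioning
   event set0, on which the gain has neither a minimum nor a maximum. *)
Definition coherent (Omega : Type) (R : realType) (I : Type)
    (X : I -> cond_rq Omega R) (mu : I -> R) : Prop :=
  forall (r : nat) (f : 'I_r.+1 -> I), injective f ->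
  forall s : 'I_r.+1 -> R,
    let G := gain (X \o f) (mu \o f) s in
    let K := \bigcup_j rq_cond (X (f j)) in
    exists m M : R,
      [/\ is_min (G @` K) m, is_max (G @` K) M, m <= 0 & 0 <= M].

Definition ce_true (Omega : Type) (E H : set Omega) : set Omega := E `&` H.
Definition ce_false (Omega : Type) (E H : set Omega) : set Omega := ~` E `&` H.
Definition ce_void (Omega : Type) (H : set Omega) : set Omega := ~` H.

(* The library declares [\1_E] as a {fimfun _ >-> _} only on pointed types. *)
Definition event_val (Omega : Type) (R : realType) (E : set Omega) :
    Omega -> R := \1_E.

Lemma event_val_finite_image (Omega : Type) (R : realType) (E : set Omega) :
  @FiniteImage Omega R (event_val R E).
Proof.
split; apply: (@sub_finite_set _ _ [set 0; 1]); last exact: finite_set2.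
move=> _ [w _ <-]; rewrite /event_val indicE.
by case: (w \in E); [right | left].
Qed.

HB.instance Definition _ (Omega : Type) (R : realType) (E : set Omega) :=
  event_val_finite_image R E.

Definition cond_event (Omega : Type) (R : realType) (E H : set Omega) :
    cond_rq Omega R :=
  CondRQ (event_val R E) H.

Definition conj_val (Omega : Type) (R : realType) (n : nat)
    (E H : 'I_n -> set Omega) (x : {set 'I_n} -> R) (S : {set 'I_n})
    (w : Omega) : R :=
  if [forall i in S, w \in ce_true (E i) (H i)] then 1
  else if [exists i in S, w \in ce_false (E i) (H i)] then 0
  else x [set i in S | w \in ce_void (H i)]%SET.

Lemma conj_val_finite_image (Omega : Type) (R : realType) (n : nat)
    (E H : 'I_n -> set Omega) (x : {set 'I_n} -> R) (S : {set 'I_n}) :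
  @FiniteImage Omega R (conj_val E H x S).
Proof.
split.
apply: (@sub_finite_set _ _ ([set 1; 0] `|` x @` setT)).
  move=> _ [w _ <-]; rewrite /conj_val.
  case: ifP => _; first by left; left.
  case: ifP => _; first by left; right.
  by right; exists [set i in S | w \in ce_void (H i)]%SET.
rewrite finite_setU; split; first exact: finite_set2.
by apply: finite_image; exact: finite_finset.
Qed.

HB.instance Definition _ (Omega : Type) (R : realType) (n : nat)
    (E H : 'I_n -> set Omega) (x : {set 'I_n} -> R) (S : {set 'I_n}) :=
  conj_val_finite_image E H x S.

Definition conjunction (Omega : Type) (R : realType) (n : nat)
    (E H : 'I_n -> set Omega) (x : {set 'I_n} -> R) (S : {set 'I_n}) :
    cond_rq Omega R :=
  CondRQ (conj_val E H x S) (\bigcup_(i in [set` S]) H i).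

Definition i1 : 'I_3 := @Ordinal 3 0 isT.
Definition i2 : 'I_3 := @Ordinal 3 1 isT.
Definition i3 : 'I_3 := @Ordinal 3 2 isT.

(* Points (x1, x2, x3, x12, x13, x23, x123). *)
Definition point7 (R : realType) : Type := (R * R * R * R * R * R * R)%type.

(* x_V for nonempty V; the value 0 at the empty set is never used. *)
Definition prevision_of (R : realType) (M : point7 R) (V : {set 'I_3}) : R :=
  let: (x1, x2, x3, x12, x13, x23, x123) := M in
  match i1 \in V, i2 \in V, i3 \in V with
  | true, false, false => x1
  | false, true, false => x2
  | false, false, true => x3
  | true, true, false => x12
  | true, false, true => x13
  | false, true, true => x23
  | true, true, true => x123
  | false, false, false => 0
  end.

Definition family (Omega : Type) (R : realType) (E H : 'I_3 -> set Omega)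
    (M : point7 R) : 7.-tuple (cond_rq Omega R) :=
  let conj := conjunction E H (prevision_of M) in
  [tuple cond_event R (E i1) (H i1);
         cond_event R (E i2) (H i2);
         cond_event R (E i3) (H i3);
         conj [set i1; i2]%SET;
         conj [set i1; i3]%SET;
         conj [set i2; i3]%SET;
         conj [set i1; i2; i3]%SET].

Definition assessment (R : realType) (M : point7 R) : 7.-tuple R :=
  let: (x1, x2, x3, x12, x13, x23, x123) := M in
  [tuple x1; x2; x3; x12; x13; x23; x123].

Definition coherent_assessments (Omega : Type) (R : realType)
    (E H : 'I_3 -> set Omega) : set (point7 R) :=
  [set M | coherent (tnth (family E H M)) (tnth (assessment M))].

(* Main.v *)
Require Import Defs.
From mathcomp Require Import all_boot all_order all_algebra.
From mathcomp Require Import all_classical reals numfun.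
From mathcomp Require Import ring lra.

Set Implicit Arguments.
Unset Strict Implicit.
Unset Printing Implicit Defensive.

Import Order.TTheory GRing.Theory Num.Theory.

Local Open Scope ring_scope.

(** Let y B be the prevision of the conjunction over B, and 1 when B is empty.
Inclusion-exclusion on y gives, for T a subset of S, a number [atom y S T] which
would be the probability that, among the indices in S, exactly those in T are
true.  The theorem holds because an assessment is coherent exactly when all the
numbers [atom y setT T] are nonnegative ([coherent_conjunctionsP], valid for any
number of conditional events).  For three conditional events these are the
probabilities of eight constituents: the bounds on x123 say that they are
nonnegative, and all other inequalities of the theorem follow by adding some of
these bounds.

If the atoms are nonnegative, they are the weights of a probability on the 2^n
worlds in which no conditional event is void and which logical independence
provides.  By Moebius inversion ([sum_atom]) each y B is the expectation of the
conjunction over B, so every gain has expectation zero, hence is somewhere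
nonnegative.  These worlds belong to the conditioning event of every
subfamily, which is why the same worlds serve for all of them.

Conversely, suppose that [atom y S T] is negative, with S of minimal size, and
bet on all conjunctions over subsets of S with the coefficients of that atom.
In a world, the gain is the difference between the atom computed from the values
of the conjunctions in that world and [atom y S T].  A void conditional event
makes conjunctions take previsions as values, so the former atom is not just 0
or 1; but it is either 0 or an atom of y over the void part of S
([atom_void_val_ge0]).  Unless all of S is void, that part is smaller than S, so
this atom is nonnegative by minimality and the gain is positive: a sure gain,
against coherence. *)

(** * Inclusion-exclusion on the subsets of a finite set *)
Section Atoms.

Import mathcomp.boot.fintype mathcomp.boot.finset.

(** If y D is the probability that all events indexed by D occur, this is the
probability that, among the events indexed by S, exactly those indexed by T
occur; it is 0 when T is not a subset of S. *)
Definition atom (R : pzRingType) (I : finType) (y : {set I} -> R)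
    (S T : {set I}) : R :=
  \sum_(D : {set I} | (T \subset D) && (D \subset S)) (-1) ^+ #|D :\: T| * y D.

Lemma big_split_mem (R : nmodType) (I : finType) (i : I) (F : {set I} -> R) :
  \sum_D F D = \sum_(D : {set I} | i \notin D) (F D + F (i |: D)).
Proof.
rewrite (bigID (fun D : {set I} => i \notin D)) /= big_split /=; congr +%R.
rewrite (reindex_onto (fun D => i |: D) (fun D => D :\ i)) /=; last first.
  by move=> D; rewrite negbK; exact: setD1K.
apply: eq_bigl => D; rewrite setU11 /=; apply/eqP/idP => [<-|/setU1K //].
by rewrite setD11.
Qed.

Lemma setD1_notin (I : finType) (i : I) (T : {set I}) : i \notin T -> T :\ i = T.
Proof. by move=> iT; apply/setDidPl; rewrite disjoint_sym disjoints1. Qed.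

(** Deciding whether event i occurs: an occurring event is put into every
conjunction; for one that does not, the conjunctions with it are subtracted from
those without it. *)
Lemma atom_rec (R : pzRingType) (I : finType) (y : {set I} -> R)
    (S T : {set I}) (i : I) : i \in S ->
  atom y S T =
  atom (fun D => if i \in T then y (i |: D) else y D - y (i |: D))
    (S :\ i) (T :\ i).
Proof.
move=> iS; rewrite /atom big_mkcond (big_split_mem i) [RHS]big_mkcond.
rewrite [LHS]big_mkcond; apply: eq_bigr => D _ /=.
case: (boolP (i \in D)) => iD /=.
  by rewrite subsetD1 iD !andbF.
have TD : (T :\ i \subset D) = (T \subset i |: D) by rewrite subDset.
have DS : (D \subset S :\ i) = (D \subset S) by rewrite subsetD1 iD andbT.
have US : (i |: D \subset S) = (D \subset S) by rewrite subUset sub1set iS.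
rewrite TD DS US; case: (boolP (i \in T)) => iT.
  have -> : (T \subset D) = false.
    by apply: contraNF iD => /subsetP; exact.
  rewrite /= add0r.
  suff -> : D :\: (T :\ i) = (i |: D) :\: T by [].
  by apply/setP => k; rewrite !inE; case: eqP => // ->; rewrite iT (negPf iD).
have -> : T :\ i = T by exact: setD1_notin.
have -> : (T \subset i |: D) = (T \subset D).
  by rewrite -TD setD1_notin.
case: ifP => _; last by rewrite addr0.
have -> : (i |: D) :\: T = i |: (D :\: T).
  by apply/setP => k; rewrite !inE; case: eqP => // ->; rewrite iT.
by rewrite cardsU1 inE (negPf iD) andbF /= exprS mulN1r mulrBr mulNr.
Qed.

Lemma atom_diag (R : pzRingType) (I : finType) (y : {set I} -> R) (S : {set I}) :
  atom y S S = y S.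
Proof.
rewrite /atom (big_pred1 S) => [|D]; first by rewrite setDv cards0 mul1r.
by rewrite -eqEsubset eq_sym.
Qed.

(** Moebius inversion.  It is the additivity of probability: the atoms in which
all of A occurs are a partition of the conjunction over A.  The induction removes
an index i outside of A, because the two atoms which differ only in i add up to
an atom over S minus i. *)
Lemma sum_atom (R : pzRingType) (I : finType) (y : {set I} -> R)
    (S A : {set I}) : A \subset S ->
  \sum_(T : {set I} | (A \subset T) && (T \subset S)) atom y S T = y A.
Proof.
have [n] := ubnP #|S|; elim: n S => // n IHn S leSn AS.
have [->|neSA] := eqVneq A S.
  rewrite (big_pred1 S) => [|D]; last by rewrite -eqEsubset eq_sym.
  exact: atom_diag.
have /properP[_ [i iS iA]] : A \proper S by rewrite properEneq neSA.
rewrite -(IHn (S :\ i)); last first.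
- by rewrite subsetD1 AS.
- by rewrite (cardsD1 i) iS in leSn.
rewrite [LHS]big_mkcond (big_split_mem i) [LHS]big_mkcond [RHS]big_mkcond.
apply: eq_bigr => T _ /=.
case: (boolP (i \in T)) => iT /=; first by rewrite subsetD1 iT !andbF.
have AT : (A \subset i |: T) = (A \subset T).
  by rewrite -subDset setD1_notin.
rewrite AT subUset sub1set iS subsetD1 iT andbT /=.
case: ifP => _; last by rewrite addr0.
have TiT : T :\ i = T by exact: setD1_notin.
rewrite (atom_rec y _ iS) (atom_rec y (i |: T) iS) setU11 (negPf iT) setU1K // TiT.
rewrite /atom -big_split; apply: eq_bigr => D _ /=.
by rewrite -mulrDr subrK.
Qed.

(** The value of the conjunction over B in a world where F and V are the sets of
indices of the false and of the void conditional events.  When no index of B is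
in F or V the conjunction is true, and its value 1 is then y set0, for the y used
below. *)
Definition void_val (R : pzRingType) (I : finType) (y : {set I} -> R)
    (F V B : {set I}) : R :=
  if [disjoint B & F] then y (B :&: V) else 0.

(** A conditional event which is true or false contributes to the atom a factor 1
or 0, according to whether its truth value agrees with T; so indices outside of V
can be removed one by one, until the conjunctions take their previsions as
values. *)
Lemma atom_void_val_ge0 (R : numDomainType) (I : finType) (y : {set I} -> R)
    (F V S T : {set I}) :
  [disjoint F & V] ->
  (forall S' T' : {set I}, S' \subset S :&: V -> 0 <= atom y S' T') ->
  0 <= atom (void_val y F V) S T.
Proof.
move=> dFV; have [n] := ubnP #|S|; elim: n S T => // n IHn S T leSn y_ge0.
have [SV|] := boolP (S \subset V).
  have -> : atom (void_val y F V) S T = atom y S T.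
    apply: eq_bigr => D /andP[_ DS]; congr (_ * _); rewrite /void_val.
    have DV := subset_trans DS SV.
    by rewrite (setIidPl DV) disjoint_sym (disjointWr DV).
  by apply: y_ge0; rewrite subsetI subxx.
case/subsetPn => i iS iV; rewrite (atom_rec _ _ iS).
have IH : 0 <= atom (void_val y F V) (S :\ i) (T :\ i).
  apply: IHn; first by rewrite (cardsD1 i) iS in leSn.
  move=> S' T' S'S; apply: y_ge0; apply: (subset_trans S'S).
  by apply: setSI; exact: subD1set.
have addF D : i \in F -> void_val y F V (i |: D) = 0.
  move=> iF; rewrite /void_val ifF //; apply/negbTE/pred0Pn; exists i.
  by rewrite /= setU11.
have addT D : i \notin F -> void_val y F V (i |: D) = void_val y F V D.
  move=> iF; rewrite /void_val -!setI_eq0 !setIUl.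
  by rewrite !(disjoint_setI0 (_ : [disjoint [set i] & _])) ?disjoints1 ?set0U.
have [iF|iF] := boolP (i \in F); case: (i \in T).
- by rewrite /atom big1 // => D _; rewrite addF ?mulr0.
- rewrite (_ : atom _ _ _ = atom (void_val y F V) (S :\ i) (T :\ i)) //.
  by apply: eq_bigr => D _; rewrite addF // subr0.
- rewrite (_ : atom _ _ _ = atom (void_val y F V) (S :\ i) (T :\ i)) //.
  by apply: eq_bigr => D _; rewrite addT.
- by rewrite /atom big1 // => D _; rewrite addT // subrr mulr0.
Qed.

End Atoms.

(** * Coherence as nonnegativity of the maximal gain *)
Section Subfamilies.

Import mathcomp.boot.fintype mathcomp.boot.finset.

Lemma enum_subfamily (I : finType) (J : {set I}) : J != set0 ->
  exists r (f : 'I_r.+1 -> I), injective f /\ f @: [set: 'I_r.+1] = J.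
Proof.
rewrite -card_gt0 => J0; exists #|J|.-1.
exists (fun k => enum_val (cast_ord (prednK J0) k)); split.
  by move=> k l /enum_val_inj /cast_ord_inj.
apply/setP => j; apply/imsetP/idP => [[k _ ->]|jJ]; first exact: enum_valP.
exists (cast_ord (esym (prednK J0)) (enum_rank_in jJ j)); first exact: in_setT.
by rewrite cast_ordKV enum_rankK_in.
Qed.

End Subfamilies.

Section Gains.

Local Open Scope classical_set_scope.
Local Open Scope ring_scope.

Lemma finite_max (R : realType) (A : set R) :
  finite_set A -> A !=set0 -> exists M, is_max A M.
Proof.
move=> /finite_seqP[s ->]; elim: s => [|a s IHs] [x xs] //.
have [s0|s_neq0] := eqVneq s [::].
  exists a; split; first exact: mem_head.
  by move=> y /=; rewrite s0 inE => /eqP ->.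
have [|M [Ms Mub]] := IHs.
  by case: s s_neq0 {IHs xs} => // b s _; exists b; exact: mem_head.
exists (Num.max a M); split=> /=.
  by rewrite /Num.max; case: ifP => _; rewrite inE ?eqxx ?Ms ?orbT.
move=> y; rewrite /= inE => /predU1P[->|/Mub yM]; first by rewrite le_max lexx.
by rewrite le_max yM orbT.
Qed.

Lemma finite_range_sum (Omega : Type) (R : realType) (r : nat)
    (g : 'I_r -> Omega -> R) :
  (forall j, finite_set (range (g j))) ->
  finite_set (range (fun w => \sum_j g j w)).
Proof.
move=> fin_g; elim: (index_enum _) => [|j s IHs].
  apply: (sub_finite_set _ (finite_set1 0)) => _ [w _ <-].
  by rewrite big_nil.
apply: (sub_finite_set _ (finite_image2 +%R (fin_g j) IHs)) => _ [w _ <-].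
rewrite big_cons; exists (g j w); first by exists w.
by exists (\sum_(i <- s) g i w) => //; exists w.
Qed.

Lemma finite_gain (Omega : Type) (R : realType) (r : nat)
    (X : 'I_r -> cond_rq Omega R) (mu s : 'I_r -> R) :
  finite_set (range (gain X mu s)).
Proof.
apply: finite_range_sum => j.
have fin_X : finite_set (range (rq_val (X j))) by exact: fimfunP.
have fin_K : finite_set (range (event_val R (rq_cond (X j)))).
  by case: (event_val_finite_image R (rq_cond (X j))).
pose h (k v : R) := s j * k * (v - mu j).
apply: (sub_finite_set _ (finite_image2 h fin_K fin_X)).
move=> _ [w _ <-]; exists (\1_(rq_cond (X j)) w); first by exists w.
by exists (rq_val (X j) w) => //; exists w.
Qed.

Lemma gainN (Omega : Type) (R : realType) (r : nat)
    (X : 'I_r -> cond_rq Omega R) (mu s : 'I_r -> R) w :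
  gain X mu (- s) w = - gain X mu s w.
Proof. by rewrite -sumrN; apply: eq_bigr => j _; rewrite !mulNr. Qed.

(** The gain takes finitely many values, so its extrema exist as soon as the
conditioning event is possible; and replacing s by its opposite exchanges them,
so that the condition on the maximum, for all s, implies the one on the minimum.
*)
Lemma coherentP (Omega : Type) (R : realType) (I : finType)
    (X : I -> cond_rq Omega R) (mu : I -> R) :
  coherent X mu <->
  forall (J : {set I}) (s : I -> R), J != finset.set0 ->
    exists w, (exists2 j, j \in J & rq_cond (X j) w) /\
      0 <= \sum_(j in J) s j * \1_(rq_cond (X j)) w * (rq_val (X j) w - mu j).
Proof.
split=> [coh J s /enum_subfamily[r [f [f_inj <-]]]|arb r f f_inj].
  have [m [M [_ [[w [k _ kw] <-] _] _ M0]]] := coh r f f_inj (s \o f).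
  exists w; split; first by exists (f k) => //; exact: imset_f.
  rewrite big_imset /=; last by move=> ? ? _ _; exact: f_inj.
  by rewrite (eq_bigl predT) // => j; rewrite inE.
pose K := \bigcup_j rq_cond (X (f j)).
have maxG s : exists M, is_max (gain (X \o f) (mu \o f) s @` K) M /\ 0 <= M.
  pose s' j := \sum_(k | f k == j) s k.
  have [|w [[_ /imsetP[k _ ->] kw] Gw]] := arb [set f k | k : 'I_r.+1]%SET s'.
    by apply/set0Pn; exists (f ord0); apply: imset_f.
  have Kw : K w by exists k.
  have Gw0 : 0 <= gain (X \o f) (mu \o f) s w.
    move: Gw; rewrite big_imset /=; last by move=> ? ? _ _; exact: f_inj.
    rewrite (eq_bigl predT) => [|l]; last by rewrite inE.
    congr (0 <= _); apply: eq_bigr => l _; rewrite /s' (big_pred1 l) // => i /=.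
    by rewrite (inj_eq f_inj).
  have [| |M [MG Mub]] := @finite_max R (gain (X \o f) (mu \o f) s @` K).
  - apply: (sub_finite_set _ (finite_gain (X \o f) (mu \o f) s)).
    by move=> _ [v _ <-]; exists v.
  - by exists (gain (X \o f) (mu \o f) s w); exists w.
  exists M; split=> //; apply: le_trans Gw0 _; apply: Mub; by exists w.
move=> s G; have [M [maxM M0]] := maxG s.
have [m [[[w Kw <-] mub] m0]] := maxG (- s).
exists (gain (X \o f) (mu \o f) s w), M; split=> //.
  split; first by exists w.
  move=> _ [v Kv <-]; rewrite -lerN2 -!gainN; apply: mub; by exists v.
by rewrite -oppr_ge0 -gainN.
Qed.

End Gains.

(** * Coherence of the conjunctions of n conditional events *)
Section Conjunctions.

Import mathcomp.boot.fintype mathcomp.boot.finset.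

(** The conjunction of no conditional event is sure.  Giving it the prevision 1
lets [void_val] cover at once true, false and partly void conjunctions. *)
Definition extend1 (R : pzRingType) (I : finType) (x : {set I} -> R)
    (B : {set I}) : R :=
  if B == set0 then 1 else x B.

Definition void_idx (Omega : Type) (n : nat) (H : 'I_n -> set Omega)
    (w : Omega) : {set 'I_n} :=
  [set i | w \in ce_void (H i)].

Definition false_idx (Omega : Type) (n : nat) (E H : 'I_n -> set Omega)
    (w : Omega) : {set 'I_n} :=
  [set i | w \in ce_false (E i) (H i)].

Lemma true_false_void (Omega : Type) (E H : set Omega) (w : Omega) :
  (w \in ce_true E H) = (w \notin ce_false E H) && (w \notin ce_void H).
Proof.
rewrite /ce_true /ce_false /ce_void !classical_sets.in_setI !classical_sets.in_setC.
by case: (w \in E); case: (w \in H).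
Qed.

Lemma disjoint_false_void (Omega : Type) (n : nat) (E H : 'I_n -> set Omega)
    (w : Omega) : [disjoint false_idx E H w & void_idx H w].
Proof.
apply/pred0P => i; rewrite /= !inE /ce_false /ce_void.
rewrite classical_sets.in_setI !classical_sets.in_setC.
by case: (w \in H i); rewrite ?andbF.
Qed.

Lemma conj_valE (Omega : Type) (R : realType) (n : nat)
    (E H : 'I_n -> set Omega) (x : {set 'I_n} -> R) (S : {set 'I_n})
    (w : Omega) :
  conj_val E H x S w =
  void_val (extend1 x) (false_idx E H w) (void_idx H w) S.
Proof.
have -> : conj_val E H x S w =
  if [disjoint S & false_idx E H w] then
    if S :&: void_idx H w == set0 then 1 else x (S :&: void_idx H w)
  else 0; last by [].
have SV : [set i in S | w \in ce_void (H i)] = S :&: void_idx H w.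
  by apply/setP => i; rewrite !inE.
have SF : [exists i in S, w \in ce_false (E i) (H i)]
    = ~~ [disjoint S & false_idx E H w].
  by apply: eq_existsb => i /=; rewrite inE.
have ST : [forall i in S, w \in ce_true (E i) (H i)]
    = [disjoint S & false_idx E H w] && [disjoint S & void_idx H w].
  apply/forall_inP/andP => [allT|[SnF SnV] i iS].
    by split; apply/pred0P => i; rewrite /= inE; apply/negP => /andP[/allT];
      rewrite true_false_void => /andP[/negPf SnF /negPf SnV]; rewrite ?SnF ?SnV.
  rewrite true_false_void; move: (disjointFr SnF iS) (disjointFr SnV iS).
  by rewrite !inE => -> ->.
rewrite /conj_val SV SF ST setI_eq0.
by case: [disjoint S & false_idx E H w].
Qed.

(** The values of X j are compared only on its conditioning event, so that
a conditional event is the conjunction over a singleton. *)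
Definition lists_conjunctions (Omega : Type) (R : realType) (n : nat)
    (E H : 'I_n -> set Omega) (x : {set 'I_n} -> R) (I : finType)
    (X : I -> cond_rq Omega R) (mu : I -> R) : Prop :=
  exists sg : I -> {set 'I_n},
    [/\ injective sg,
        forall B : {set 'I_n}, B != set0 <-> exists j, sg j = B,
        forall j, rq_cond (X j) = rq_cond (conjunction E H x (sg j)),
        forall j w, rq_cond (X j) w -> rq_val (X j) w = conj_val E H x (sg j) w
      & forall j, mu j = x (sg j)].

Lemma conj_condP (Omega : Type) (R : realType) (n : nat)
    (E H : 'I_n -> set Omega) (x : {set 'I_n} -> R) (B : {set 'I_n})
    (w : Omega) :
  rq_cond (conjunction E H x B) w <-> ~~ (B \subset void_idx H w).
Proof.
split=> [[i iB Hiw]|/subsetPn[i iB]].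
  apply/subsetPn; exists i => //; rewrite inE /ce_void classical_sets.in_setC.
  by rewrite negbK; exact/mem_set.
rewrite inE /ce_void classical_sets.in_setC negbK => /set_mem Hiw.
by exists i.
Qed.

(** The form taken by coherence when bets are indexed by sets.  The empty set may
belong to J, and contributes nothing to the gain: this permits bets on all
subsets of a given set. *)
Definition no_sure_loss (Omega : Type) (R : realType) (n : nat)
    (E H : 'I_n -> set Omega) (x : {set 'I_n} -> R) : Prop :=
  forall (J : {set {set 'I_n}}) (s : {set 'I_n} -> R),
    (exists2 B, B \in J & B != set0) ->
  exists w, (exists2 B, B \in J & ~~ (B \subset void_idx H w)) /\
    0 <= \sum_(B in J) s B *
      (void_val (extend1 x) (false_idx E H w) (void_idx H w) B - extend1 x B).

(** In a world where all of B is void, the value [void_val] of the conjunction is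
its prevision; so the indicator of the conditioning event can be dropped from the
gain. *)
Lemma coherent_no_sure_loss (Omega : Type) (R : realType) (n : nat)
    (E H : 'I_n -> set Omega) (x : {set 'I_n} -> R) (I : finType)
    (X : I -> cond_rq Omega R) (mu : I -> R) :
  lists_conjunctions E H x X mu -> coherent X mu <-> no_sure_loss E H x.
Proof.
move=> [sg [sg_inj sgP condX valX muE]].
have sg_neq0 j : sg j != set0 by apply/sgP; exists j.
have condP j w : rq_cond (X j) w <-> ~~ (sg j \subset void_idx H w).
  by rewrite condX; exact: conj_condP.
pose d w B :=
  void_val (extend1 x) (false_idx E H w) (void_idx H w) B - extend1 x B.
have d0 w : d w set0 = 0.
  by rewrite /d /void_val set0I -setI_eq0 set0I eqxx subrr.
have termE j w : \1_(rq_cond (X j)) w * (rq_val (X j) w - mu j) = d w (sg j).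
  rewrite indicE muE; have [/[dup] wK /set_mem/valX ->|] := boolP (w \in _).
    by rewrite mul1r conj_valE /d /extend1 (negPf (sg_neq0 j)).
  move=> wK; have jV : sg j \subset void_idx H w.
    by apply: contraNT wK => jV; apply/mem_set/condP.
  rewrite mul0r /d /void_val (setIidPl jV) ifT ?subrr //.
  by rewrite disjoint_sym; exact: disjointWr jV (disjoint_false_void _ _ _).
have gainE (J : {set I}) s w :
    \sum_(j in J) s j * \1_(rq_cond (X j)) w * (rq_val (X j) w - mu j) =
    \sum_(j in J) s j * d w (sg j).
  by apply: eq_bigr => j _; rewrite -mulrA termE.
rewrite coherentP; split=> [arb J s [B BJ B0]|nsl J s /set0Pn[j0 j0J]].
  have [|w [[j jJ /condP jV]]] := arb (sg @^-1: J) (s \o sg).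
    have /sgP[j jB] := B0; apply/set0Pn; exists j.
    by rewrite inE jB.
  rewrite gainE => Gw; exists w; split.
    by exists (sg j) => //; rewrite inE in jJ.
  rewrite (bigID (fun B => B == set0)) /= big1 ?add0r; last first.
    by move=> D /andP[_ /eqP->]; rewrite -/(d w _) d0 mulr0.
  move: Gw; rewrite -(big_imset (fun B => s B * d w B)) /=; last first.
    by move=> ? ? _ _; exact: sg_inj.
  rewrite [X in 0 <= X -> _](eq_bigl (fun B => (B \in J) && (B != set0))) //.
  move=> D; apply/imsetP/andP => [[k kJ ->]|[DJ /sgP[k kD]]].
    by move: kJ; rewrite inE sg_neq0.
  by exists k; rewrite ?inE kD.
have [|w [[_ /imsetP[j jJ ->] jV] Gw]] :=
    nsl (sg @: J) (fun B => \sum_(j | sg j == B) s j).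
  by exists (sg j0); [exact: imset_f | exact: sg_neq0].
exists w; split; first by exists j => //; exact/condP.
move: Gw; rewrite gainE big_imset /=; last by move=> ? ? _ _; exact: sg_inj.
congr (0 <= _); apply: eq_bigr => k _; rewrite (big_pred1 k) // => i /=.
by rewrite (inj_eq sg_inj).
Qed.

(** A negative atom over a minimal S would be a sure gain for the bet opposite to
its coefficients: the values in any world of the conditioning event give an atom
which reduces to one over a smaller set. *)
Lemma no_sure_loss_atom_ge0 (Omega : Type) (R : realType) (n : nat)
    (E H : 'I_n -> set Omega) (x : {set 'I_n} -> R) (S T : {set 'I_n}) :
  no_sure_loss E H x -> 0 <= atom (extend1 x) S T.
Proof.
move=> nsl; set y := extend1 x.
have [m] := ubnP #|S|; elim: m S T => // m IHm S T leSm.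
have [->|S_neq0] := eqVneq S set0.
  rewrite /atom; apply: sumr_ge0 => D /andP[_]; rewrite subset0 => /eqP->.
  by rewrite set0D cards0 mul1r /y /extend1 eqxx.
rewrite leNgt; apply/negP => atom_lt0.
(* The stakes are opposite to the coefficients of [atom _ S T]. *)
pose s (D : {set 'I_n}) : R := - (if T \subset D then (-1) ^+ #|D :\: T| else 0).
have [|w [[B BS BV]]] := nsl (powerset S) s.
  by exists S => //; rewrite inE.
apply/negP; rewrite -ltNge -/y; set z := void_val _ _ _.
have -> : \sum_(D in powerset S) s D * (z D - y D) = atom y S T - atom z S T.
  rewrite /atom -sumrB [RHS]big_mkcondl /=.
  apply: eq_big => D; first by rewrite inE.
  by rewrite /s; case: ifP; rewrite ?oppr0 ?mul0r // mulNr -mulrN opprB mulrBr.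
rewrite subr_lt0; apply: lt_le_trans atom_lt0 _.
apply: atom_void_val_ge0 => [|S' T' S'S]; first exact: disjoint_false_void.
apply: IHm; apply: leq_ltn_trans (subset_leq_card S'S) _.
rewrite ltnS in leSm; apply: leq_trans leSm.
apply: proper_card; rewrite properEneq subsetIl andbT.
apply: contraNneq BV => SV; rewrite inE in BS.
by apply: subset_trans BS _; rewrite -SV; exact: subsetIr.
Qed.

(** Worlds without void conditional events, and with any prescribed set T of true
ones. *)
Lemma independent_world (Omega : Type) (n : nat) (E H : 'I_n -> set Omega)
    (T : {set 'I_n}) :
  logically_independent
    (fun k : 'I_n + 'I_n => match k with inl i => E i | inr i => H i end) ->
  exists w, void_idx H w = set0 /\ false_idx E H w = ~: T.
Proof.
case/(_ (fun k => match k with inl i => i \in T | inr _ => true end)) => w wT.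
have Hw i : (w \in H i) = true by apply/mem_set; exact: (wT (inr i) I).
exists w; split; apply/setP => i; rewrite !inE.
  by rewrite /ce_void classical_sets.in_setC Hw.
rewrite /ce_false classical_sets.in_setI Hw andbT classical_sets.in_setC.
congr (~~ _); have := wT (inl i) I; case: (i \in T) => /= Ei.
  exact/mem_set.
exact/memNset.
Qed.

(** Under the probability which gives weight [atom y setT T] to a world where
exactly T is true and nothing is void, every gain G has expectation zero, so it
cannot be negative everywhere. *)
Lemma atom_ge0_no_sure_loss (Omega : Type) (R : realType) (n : nat)
    (E H : 'I_n -> set Omega) (x : {set 'I_n} -> R) :
  logically_independent
    (fun k : 'I_n + 'I_n => match k with inl i => E i | inr i => H i end) ->
  (forall T, 0 <= atom (extend1 x) setT T) -> no_sure_loss E H x.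
Proof.
move=> indep; set y := extend1 x => atom_ge0 J s [B0 B0J B0_neq0].
have y0 : y set0 = 1 by rewrite /y /extend1 eqxx.
apply: contrapT => no_w.
pose G (T : {set 'I_n}) := \sum_(B in J) s B * ((B \subset T)%:R - y B).
have G_lt0 (T : {set 'I_n}) : G T < 0.
  have [w [VT FT]] := independent_world T indep.
  rewrite ltNge; apply/negP => G_ge0; apply: no_w; exists w; split.
    by exists B0 => //; rewrite VT subset0.
  rewrite VT FT; congr (0 <= _): G_ge0; apply: eq_bigr => B _.
  congr (_ * (_ - _)); rewrite /void_val setI0 -/y y0 disjoints_subset setCK.
  by case: (_ \subset _).
have expect (B : {set 'I_n}) : \sum_T atom y setT T * (B \subset T)%:R = y B.
  rewrite -(sum_atom y (subsetT B)) [RHS]big_mkcond.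
  apply: eq_bigr => T _; rewrite subsetT andbT.
  by case: ifP; rewrite ?mulr1 ?mulr0.
have sum1 : \sum_T atom y setT T = 1.
  by rewrite -y0 -(expect set0); apply: eq_bigr => T _; rewrite sub0set mulr1.
have sumG : \sum_T atom y setT T * G T = 0.
  under eq_bigr do rewrite /G mulr_sumr.
  rewrite exchange_big /= big1 // => B _.
  under eq_bigr do rewrite mulrCA mulrBr.
  by rewrite -mulr_sumr sumrB -mulr_suml sum1 mul1r expect subrr mulr0.
(* A sum of nonnegative terms which vanishes; as G is negative, all weights would
   be zero, although their sum is 1. *)
have term0 T : atom y setT T * - G T = 0.
  apply: (psumr_eq0P (P := xpredT) (F := fun T => atom y setT T * - G T)) => //.
    by move=> {}T _; rewrite mulr_ge0 ?atom_ge0 // oppr_ge0 ltW.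
  by under eq_bigr do rewrite mulrN; rewrite sumrN sumG oppr0.
suff : 1 = 0 :> R by move/eqP; rewrite oner_eq0.
rewrite -sum1 big1 // => T _; have /eqP := term0 T.
by rewrite mulf_eq0 oppr_eq0 (lt_eqF (G_lt0 T)) orbF => /eqP.
Qed.

Theorem coherent_conjunctionsP (Omega : Type) (R : realType) (n : nat)
    (E H : 'I_n -> set Omega) (x : {set 'I_n} -> R) (I : finType)
    (X : I -> cond_rq Omega R) (mu : I -> R) :
  logically_independent
    (fun k : 'I_n + 'I_n => match k with inl i => E i | inr i => H i end) ->
  lists_conjunctions E H x X mu ->
  coherent X mu <-> forall T, 0 <= atom (extend1 x) [set: 'I_n] T.
Proof.
move=> indep conjX; rewrite (coherent_no_sure_loss conjX).
split=> [nsl T|]; first exact: no_sure_loss_atom_ge0 nsl.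
exact: atom_ge0_no_sure_loss.
Qed.

End Conjunctions.

(** * Three conditional events *)
Section ThreeConditionalEvents.

Import mathcomp.boot.fintype mathcomp.boot.finset.

Lemma ord3P (i : 'I_3) : [|| i == i1, i == i2 | i == i3].
Proof. by case: i => [[|[|[|]]]]. Qed.

Lemma eq_set3 (A B : {set 'I_3}) :
  (i1 \in A) = (i1 \in B) -> (i2 \in A) = (i2 \in B) ->
  (i3 \in A) = (i3 \in B) -> A = B.
Proof. by move=> ? ? ?; apply/setP => i; case/or3P: (ord3P i) => /eqP->. Qed.

Lemma conjunction1_cond (Omega : Type) (R : realType) (n : nat)
    (E H : 'I_n -> set Omega) (x : {set 'I_n} -> R) (i : 'I_n) :
  rq_cond (conjunction E H x [set i]) = H i.
Proof.
apply/seteqP; split=> [w [k]|w Hw]; last by exists i => //=; rewrite inE.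
by rewrite /= inE => /eqP->.
Qed.

Lemma conjunction1_val (Omega : Type) (R : realType) (n : nat)
    (E H : 'I_n -> set Omega) (x : {set 'I_n} -> R) (i : 'I_n) (w : Omega) :
  H i w -> conj_val E H x [set i] w = \1_(E i) w.
Proof.
move=> /mem_set Hw; rewrite conj_valE /void_val disjoints1 inE /ce_false.
rewrite classical_sets.in_setI classical_sets.in_setC Hw andbT negbK indicE.
case: (w \in E i) => //=; rewrite /extend1 setI_eq0 disjoints1 inE /ce_void.
by rewrite classical_sets.in_setC Hw.
Qed.

Definition nonempty_sets3 : 7.-tuple {set 'I_3} :=
  [tuple [set i1]; [set i2]; [set i3]; [set i1; i2]; [set i1; i3];
         [set i2; i3]; [set i1; i2; i3]].

Lemma family_lists_conjunctions (Omega : Type) (R : realType)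
    (E H : 'I_3 -> set Omega) (M : point7 R) :
  lists_conjunctions E H (prevision_of M)
    (tnth (Defs.family E H M)) (tnth (assessment M)).
Proof.
exists (tnth nonempty_sets3); split.
- apply/tuple_uniqP.
  apply: (@map_uniq _ _ (fun B : {set 'I_3} => (i1 \in B, i2 \in B, i3 \in B))).
  by rewrite /= !inE; vm_compute.
- move=> B; split=> [B0|[[[|[|[|[|[|[|[|]]]]]]] lt_j] // <-]].
  2-8: apply/set0Pn; rewrite /tnth /=.
  2,5,6,8: by exists i1; rewrite !inE.
  2,4: by exists i2; rewrite !inE.
  2: by exists i3; rewrite !inE.
  case b1: (i1 \in B); case b2: (i2 \in B); case b3: (i3 \in B).
  8: by case/set0Pn: B0 => i; case/or3P: (ord3P i) => /eqP->; rewrite ?b1 ?b2 ?b3.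
  (* The witness is the position of B in [nonempty_sets3]. *)
  1: exists (@Ordinal 7 6 isT).
  2: exists (@Ordinal 7 3 isT).
  3: exists (@Ordinal 7 4 isT).
  4: exists (@Ordinal 7 0 isT).
  5: exists (@Ordinal 7 5 isT).
  6: exists (@Ordinal 7 1 isT).
  7: exists (@Ordinal 7 2 isT).
  1-7: by apply: eq_set3; rewrite /tnth /= !inE ?b1 ?b2 ?b3.
- case=> [[|[|[|[|[|[|[|]]]]]]] lt_j] //.
  1-3: exact: esym (conjunction1_cond E H (prevision_of M) _).
- case=> [[|[|[|[|[|[|[|]]]]]]] lt_j] // w Hw.
  1-3: exact: esym (conjunction1_val E (prevision_of M) Hw).
- move: M => [[[[[[x1 x2] x3] x12] x13] x23] x123].
  by case=> [[|[|[|[|[|[|[|]]]]]]] lt_j] //; rewrite /tnth /= !inE.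
Qed.

(** The probability of the constituent in which the i-th conditional event is true
or false according to bi, in terms of the previsions of the conjunctions. *)
Definition constituent_prob (R : realType) (M : point7 R) (b1 b2 b3 : bool) : R :=
  let: (x1, x2, x3, x12, x13, x23, x123) := M in
  match b1, b2, b3 with
  | true, true, true => x123
  | true, true, false => x12 - x123
  | true, false, true => x13 - x123
  | false, true, true => x23 - x123
  | true, false, false => x1 - x12 - x13 + x123
  | false, true, false => x2 - x12 - x23 + x123
  | false, false, true => x3 - x13 - x23 + x123
  | false, false, false => 1 - x1 - x2 - x3 + x12 + x13 + x23 - x123
  end.

Lemma extend1_prevision_of (R : realType) (M : point7 R) (B : {set 'I_3}) :
  extend1 (prevision_of M) B =
  if [|| i1 \in B, i2 \in B | i3 \in B] then prevision_of M B else 1.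
Proof.
rewrite /extend1; have [->|/set0Pn[i iB]] := eqVneq B set0; first by rewrite !inE.
by rewrite ifT //; case/or3P: (ord3P i) iB => /eqP-> ->; rewrite ?orbT.
Qed.

Lemma atom3E (R : realType) (M : point7 R) (T : {set 'I_3}) :
  atom (extend1 (prevision_of M)) setT T =
  constituent_prob M (i1 \in T) (i2 \in T) (i3 \in T).
Proof.
rewrite (@atom_rec _ _ _ _ _ i1) ?inE // (@atom_rec _ _ _ _ _ i2) ?inE //.
rewrite (@atom_rec _ _ _ _ _ i3) ?inE //=.
rewrite (_ : setT :\ i1 :\ i2 :\ i3 = set0); last by apply: eq_set3; rewrite !inE.
rewrite (_ : T :\ i1 :\ i2 :\ i3 = set0); last by apply: eq_set3; rewrite !inE.
move: M => [[[[[[x1 x2] x3] x12] x13] x23] x123].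
rewrite atom_diag; case: (i1 \in T); case: (i2 \in T); case: (i3 \in T);
by rewrite /= ?extend1_prevision_of !inE /= ?inE /=; ring.
Qed.

Lemma coherent_assessments3P (R : realType) (Omega : Type)
    (E H : 'I_3 -> set Omega) (M : point7 R) :
  logically_independent
    (fun k : 'I_3 + 'I_3 => match k with inl i => E i | inr i => H i end) ->
  coherent_assessments E H M <->
  forall b1 b2 b3, 0 <= constituent_prob M b1 b2 b3.
Proof.
move=> indep.
rewrite [X in X <-> _](coherent_conjunctionsP indep
  (family_lists_conjunctions E H M)).
split=> [atom_ge0 b1 b2 b3|prob_ge0 T]; last by rewrite atom3E.
pose T := [set i : 'I_3 | nth false [:: b1; b2; b3] i].
by have := atom_ge0 T; rewrite atom3E !inE.
Qed.

End ThreeConditionalEvents.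

Local Open Scope classical_set_scope.
Local Open Scope ring_scope.

Theorem theorem15 (R : realType) (Omega : Type) (E H : 'I_3 -> set Omega)
    (indep : logically_independent
       (fun k : 'I_3 + 'I_3 => match k with inl i => E i | inr i => H i end))
    (H_possible : forall i : 'I_3, H i !=set0) :
  coherent_assessments (R := R) E H =
  [set M : point7 R | let: (x1, x2, x3, x12, x13, x23, x123) := M in
    (0 <= x1 <= 1 /\ 0 <= x2 <= 1 /\ 0 <= x3 <= 1) /\
    (Num.max (Num.max (x1 + x2 - 1) (x13 + x23 - x3)) 0 <= x12
       <= Num.min x1 x2) /\
    (Num.max (Num.max (x1 + x3 - 1) (x12 + x23 - x2)) 0 <= x13
       <= Num.min x1 x3) /\
    (Num.max (Num.max (x2 + x3 - 1) (x12 + x13 - x1)) 0 <= x23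
       <= Num.min x2 x3) /\
    (1 - x1 - x2 - x3 + x12 + x13 + x23 >= 0) /\
    (x123 >= Num.max (Num.max (Num.max 0 (x12 + x13 - x1)) (x12 + x23 - x2))
                     (x13 + x23 - x3)) /\
    (x123 <= Num.min (Num.min (Num.min x12 x13) x23)
                     (1 - x1 - x2 - x3 + x12 + x13 + x23))].
Proof.
apply/seteqP; split=> -[[[[[[x1 x2] x3] x12] x13] x23] x123] /=;
  rewrite !ge_max !le_min.
  move/(coherent_assessments3P _ indep) => prob_ge0.
  move: (prob_ge0 true true true) (prob_ge0 true true false)
    (prob_ge0 true false true) (prob_ge0 true false false)
    (prob_ge0 false true true) (prob_ge0 false true false)
    (prob_ge0 false false true) (prob_ge0 false false false) => /=.
  (* For instance, x1 + x2 - 1 <= x12 is the sum of the inequalities for the two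
     constituents in which both the first and the second event are false. *)
  clear; move=> *; do !split; do ?[apply/andP; split]; lra.
move=> [_ [_ [_ [_ [_ [/andP[/andP[/andP[? ?] ?] ?]]]]]]].
move=> /andP[/andP[/andP[? ?] ?] ?].
by apply/(coherent_assessments3P _ indep) => -[] [] [] /=; lra.
Qed.
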